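(* Every (finite) tree $T$ is bipartite omnitonal.
   Context: $e(G)$ is the number of edges of a graph $G$. A $2$-edge coloring of $K_{n,n}$ is a partition $E(K_{n,n})=R\sqcup B$ into red edges $R$ and blue edges $B$. An $(r,b)$-colored copy of a graph $G$ is a (not necessarily induced) subgraph of $K_{n,n}$ isomorphic to $G$ with exactly $r$ red edges and exactly $b$ blue edges. For a bipartite graph $G$, let $\mathrm{bot}(n,G)$ be the minimum nonnegative integer $k<\lfloor n^2/2\rfloor$, if it exists, such that every $2$-edge coloring $E(K_{n,n})=R\sqcup B$ with $\min\{|R|,|B|\}>k$ contains an $(r,b)$-colored copy of $G$ for all integers $r,b\ge 0$ with $r+b=e(G)$. (The requirement $k<\lfloor n^2/2\rfloor$ ensures that colorings with $\min\{|R|,|B|\}>k$ exist.) The graph $G$ is bipartite omnitonal if $\mathrm{bot}(n,G)$ exists for every sufficiently large $n$. *)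

(* Defs.v *)
From mathcomp Require Import all_boot.

Set Implicit Arguments.
Unset Strict Implicit.
Unset Printing Implicit Defensive.

Record sgraph := SGraph {
  vertex :> finType;
  adj : rel vertex;
  adj_sym : symmetric adj;
  adj_irr : irreflexive adj
}.

Definition edges (G : sgraph) : {set {set G}} :=
  [set e | [exists x, exists y, adj x y && (e == [set x; y])]].

Definition graph_iso (G H : sgraph) : Prop :=
  exists f : G -> H, bijective f /\ forall x y, adj (f x) (f y) = adj x y.

(* The list c of distinct vertices is read cyclically. A list of two adjacent
   vertices passes the ucycle test but is not a cycle of a simple graph. *)
Definition is_cycle (G : sgraph) (c : seq G) : Prop :=
  ucycle (@adj G) c /\ 2 < size c.

Definition connected (G : sgraph) : Prop := forall x y : G, connect (@adj G) x y.

Definition acyclic (G : sgraph) : Prop := forall c : seq G, ~ is_cycle c.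

Definition is_tree (G : sgraph) : Prop :=
  [/\ 0 < #|G|, connected G & acyclic G].

Definition bipartite (G : sgraph) : Prop :=
  exists A : {set G}, forall x y : G, adj x y -> (x \in A) != (y \in A).

Record subgraph (K : sgraph) := Subgraph {
  sub_vertices : {set K};
  sub_edges : {set {set K}};
  sub_edgesP : sub_edges \subset edges K;
  sub_endsP : forall e, e \in sub_edges -> e \subset sub_vertices
}.

Section GraphOfSubgraph.
Variables (K : sgraph) (H : subgraph K).

Definition sub_adj (x y : {v : K | v \in sub_vertices H}) : bool :=
  [set val x; val y] \in sub_edges H.

Lemma sub_adj_sym : symmetric sub_adj.
Proof. by move=> x y; rewrite /sub_adj setUC. Qed.

Lemma sub_adj_irr : irreflexive sub_adj.
Proof.
move=> x; apply/negP => /(subsetP (sub_edgesP H)).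
rewrite inE => /existsP[u /existsP[v /andP[uv /eqP e]]].
have := set21 u v; have := set22 u v.
rewrite -e !inE !orbb => /eqP ev /eqP eu.
by rewrite eu ev adj_irr in uv.
Qed.

Definition graph_of_subgraph : sgraph := SGraph sub_adj_sym sub_adj_irr.

End GraphOfSubgraph.

Section CompleteBipartite.
Variable n : nat.

Definition Knn_adj (u v : 'I_n + 'I_n) : bool :=
  match u, v with
  | inl _, inr _ | inr _, inl _ => true
  | _, _ => false
  end.

Lemma Knn_adj_sym : symmetric Knn_adj.
Proof. by move=> [?|?] [?|?]. Qed.

Lemma Knn_adj_irr : irreflexive Knn_adj.
Proof. by case. Qed.

Definition Knn : sgraph := SGraph Knn_adj_sym Knn_adj_irr.

End CompleteBipartite.

(* Color classes are allowed to be empty. *)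
Definition two_coloring (n : nat) (R B : {set {set Knn n}}) : Prop :=
  R :|: B = edges (Knn n) /\ [disjoint R & B].

Definition has_colored_copy (n : nat) (R B : {set {set Knn n}}) (G : sgraph)
    (r b : nat) : Prop :=
  exists H : subgraph (Knn n),
    [/\ graph_iso G (graph_of_subgraph H),
        #|sub_edges H :&: R| = r & #|sub_edges H :&: B| = b].

Definition bot_admissible (n : nat) (G : sgraph) (k : nat) : Prop :=
  k < (n ^ 2)./2 /\
  forall R B : {set {set Knn n}}, two_coloring R B -> k < minn #|R| #|B| ->
  forall r b : nat, r + b = #|edges G| -> has_colored_copy R B G r b.

(* The partial function bot, given by its graph: bot(n, G) = k. *)
Definition is_bot (n : nat) (G : sgraph) (k : nat) : Prop :=
  bot_admissible n G k /\ forall k', bot_admissible n G k' -> k <= k'.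

Definition bipartite_omnitonal (G : sgraph) : Prop :=
  bipartite G /\
  exists n0 : nat, forall n : nat, n0 <= n -> exists k : nat, is_bot n G k.

(* Main.v *)
(* It suffices to treat k = floor(n^2/2) - 1, i.e. balanced colorings. Each color
   then has positive density, so by Kovari-Sos-Turan there are large complete
   bipartite subgraphs, A1 x B1 in red and A2 x B2 in blue. By bipartite Ramsey
   A1 x B2 may be assumed monochromatic after shrinking; whichever color it has,
   one gets large sets C, D, E with C x E red and D x E blue (C and D on the same
   side).
   In a tree, the larger part X of the bipartition has degree sum
   |V| - 1 < 2|X|, and a list of positive integers with sum less than twice its
   length has every subset sum. So some Z in X meets exactly r edges; embed Z in
   C, X minus Z in D and the other part in E. *)
Require Import Defs.
From mathcomp Require Import all_boot zify.
From Stdlib Require Import Classical.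

Set Implicit Arguments.
Unset Strict Implicit.
Unset Printing Implicit Defensive.

(** * Minimal witnesses and subset sums *)

Lemma ex_least (P : nat -> Prop) (n : nat) :
  P n -> exists k, P k /\ forall k', P k' -> k <= k'.
Proof.
elim/ltn_ind: n => n IHn Pn.
case: (classic (exists2 k, P k & k < n)) => [[k Pk /IHn]|Hn]; first exact.
exists n; split=> // k Pk; rewrite leqNgt; apply/negP => ltkn.
by apply: Hn; exists k.
Qed.

Lemma ex_subset_card (W : finType) (A : {set W}) (t : nat) :
  t <= #|A| -> exists2 B : {set W}, B \subset A & #|B| = t.
Proof.
move=> tA; exists [set x in take t (enum A)].
  by apply/subsetP=> x; rewrite inE => /mem_take; rewrite mem_enum.
rewrite cardsE (card_uniqP _) ?take_uniq ?enum_uniq //.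
by rewrite size_takel // -cardE.
Qed.

(** Induction on [#|A|]. Removing an [x] with [d x > 1] preserves the upper bound; by positivity the
    rest sums to at least [#|A| - 1], so [d x <= #|A|]. A target [r] too big for the rest is then at
    least [#|A|], so [x] can be taken and [r - d x] is not truncated. *)
Lemma subset_sums (W : finType) (d : W -> nat) (A : {set W}) (r : nat) :
  (forall x, x \in A -> 0 < d x) -> \sum_(x in A) d x < 2 * #|A| ->
  r <= \sum_(x in A) d x -> exists2 Z : {set W}, Z \subset A & \sum_(x in Z) d x = r.
Proof.
have [k] := ubnP #|A|; elim: k A r => // k IHk A r ltAk dA sumA ler.
have [A1|] := boolP [forall x in A, d x == 1].
  have sum1 (Z : {set W}) : Z \subset A -> \sum_(x in Z) d x = #|Z|.
    move=> /subsetP ZA; rewrite -sum1_card; apply: eq_bigr => x /ZA xA.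
    exact/eqP/(forall_inP A1).
  rewrite sum1 // in ler; have [Z ZA cZ] := ex_subset_card ler.
  by exists Z; rewrite ?sum1.
rewrite negb_forall_in => /exists_inP[x xA dx1].
have dx := dA x xA.
have sumx : \sum_(y in A) d y = d x + \sum_(y in A :\ x) d y by rewrite (big_setD1 x).
have cardx : #|A| = #|A :\ x|.+1 by rewrite (cardsD1 x A) xA.
have dA' y : y \in A :\ x -> 0 < d y by move=> /setD1P[_ /dA].
have leA' : #|A :\ x| <= \sum_(y in A :\ x) d y.
  by rewrite -sum1_card; apply: leq_sum => y /dA'.
have [ler'|ltr] := leqP r (\sum_(y in A :\ x) d y).
  have [||||Z ZA sZ] := IHk (A :\ x) r => //; try lia.
  by exists Z => //; apply: subset_trans ZA (subsetDl _ _).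
have [||||Z ZA sZ] := IHk (A :\ x) (r - d x) => //; try lia.
exists (x |: Z).
  by rewrite subUset sub1set xA (subset_trans ZA) ?subsetDl.
rewrite big_setU1 ?sZ /=; first lia.
by apply/negP => /(subsetP ZA); rewrite !inE eqxx.
Qed.

(** * Bicliques in dense bipartite relations *)

(* Greedy form of Kovari-Sos-Turan: some vertex of X is adjacent to a 1/c fraction of
   V; keep it together with its neighbours in V and iterate. *)
Lemma common_neighbors (W : finType) (e : rel W) (c d s : nat) (t : nat)
    (X V : {set W}) :
  0 < c -> 0 < s ->
  (forall v, v \in V -> d + t <= #|[set u in X | e u v]|) ->
  #|X| <= c * d -> c ^ t * s <= #|V| ->
  exists A B : {set W}, [/\ A \subset X, B \subset V, #|A| = t, s <= #|B| &
    forall a b, a \in A -> b \in B -> e a b].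
Proof.
move=> c0 s0; elim: t X V => [|t IHt] X V degV cardX cardV.
  exists set0, V; split; rewrite ?sub0set ?cards0 //; first by rewrite mul1n in cardV.
  by move=> a b; rewrite inE.
have V0 : 0 < #|V| by apply: leq_trans cardV; rewrite muln_gt0 expn_gt0 c0.
have [/exists_inP[x xX Vx]|/negP noX] :=
    boolP [exists x in X, #|V| <= c * #|[set v in V | e x v]|]; last first.
  (* Double counting: if every [u] in [X] saw fewer than [#|V| / c] vertices of [V], the degrees
     [d + t.+1] would force [#|X| > c * d]. *)
  have dcount : \sum_(v in V) #|[set u in X | e u v]| =
                \sum_(u in X) #|[set v in V | e u v]|.
    under eq_bigr do rewrite -sum1dep_card big_mkcondr.
    rewrite exchange_big /=; apply: eq_bigr => u _.
    by rewrite -sum1dep_card big_mkcondr.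
  have lo : #|V| * (d + t.+1) <= \sum_(v in V) #|[set u in X | e u v]|.
    by rewrite -sum_nat_const; apply: leq_sum.
  have hi : \sum_(u in X) c * #|[set v in V | e u v]| <= #|X| * #|V|.
    rewrite -sum_nat_const; apply: leq_sum => u uX; rewrite leqNgt.
    by apply/negP => h; apply: noX; apply/exists_inP; exists u; rewrite // ltnW.
  rewrite -big_distrr -dcount /= in hi; exfalso.
  move: lo hi; set S := \sum_(v in V) _; nia.
(* Deleting [x] costs each vertex one neighbour, which the drop from [t.+1] to [t] in the degree
   bound absorbs. *)
have [|||A [B [AX BV cA cB eAB]]] := IHt (X :\ x) [set v in V | e x v].
- move=> v /setIdP[vV exv].
  have := degV v vV; rewrite (cardsD1 x) inE xX exv /= add1n addnS ltnS.
  by move/leq_trans; apply; apply/subset_leq_card/subsetP => u; rewrite !inE andbA.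
- by apply: leq_trans cardX; apply/subset_leq_card/subsetDl.
- by rewrite -(leq_pmul2l c0) mulnA -expnS (leq_trans cardV).
exists (x |: A), B; split=> //.
- by rewrite subUset sub1set xX (subset_trans AX) ?subsetDl.
- by apply: subset_trans BV _; apply/subsetP => v /setIdP[].
- rewrite cardsU1 cA; case: (boolP (x \in A)) => // /(subsetP AX).
  by rewrite !inE eqxx.
- move=> a b /setU1P[->|aA] bB; last exact: eAB.
  by have /setIdP[] := subsetP BV b bB.
Qed.

(* At least n/8 vertices of Y have degree at least n/8 >= floor(n/16) + t in X;
   common_neighbors is then applied with c = 32 and d = floor(n/16). *)
Definition KST_bound (t : nat) := 8 * (32 ^ t * t) + 16 * t.

Lemma dense_biclique (W : finType) (e : rel W) (t n : nat) (X Y : {set W}) :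
  0 < t -> KST_bound t <= n -> #|X| = n -> #|Y| = n ->
  n ^ 2 <= 4 * \sum_(v in Y) #|[set u in X | e u v]| ->
  exists A B : {set W}, [/\ A \subset X, B \subset Y, #|A| = t, #|B| = t &
    forall a b, a \in A -> b \in B -> e a b].
Proof.
rewrite /KST_bound => t0 nt cX cY dens.
pose V := [set v in Y | n <= 8 * #|[set u in X | e u v]|].
have VY : V \subset Y by apply/subsetP => v /setIdP[].
have cV : n <= 8 * #|V|.
  (* Vertices in [V] contribute at most [n] each, the others less than [n / 8]; the density
     hypothesis then leaves [8 * #|V| >= n]. *)
  have hi : 8 * (\sum_(v in Y) #|[set u in X | e u v]|) <= #|V| * (8 * n) + #|Y| * n.
    rewrite (big_setID V) /= (setIidPr VY) mulnDr !big_distrr /=; apply: leq_add.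
      rewrite -sum_nat_const; apply: leq_sum => v _; rewrite leq_mul2l /= -cX.
      by apply/subset_leq_card/subsetP => u /setIdP[].
    apply: (@leq_trans (#|Y :\: V| * n)).
      rewrite -sum_nat_const; apply: leq_sum => v; rewrite !inE => /andP[/[swap] ->].
      by rewrite /= -ltnNge => /ltnW.
    by rewrite leq_mul2r subset_leq_card ?subsetDl ?orbT.
  rewrite cY in hi; move: dens hi; set S := \sum_(v in Y) _ => dens hi.
  have n0 : 0 < n by lia.
  rewrite -(leq_pmul2r n0); rewrite expnS expn1 in dens; nia.
have [|||A [B [AX BV cA cB eAB]]] :=
    @common_neighbors W e 32 (n %/ 16) t t X V isT t0; rewrite ?cX.
- by move=> v /setIdP[_]; lia.
- lia.
- by lia.
have [B' BB' cB'] := ex_subset_card cB.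
exists A, B'; split=> //; first exact: subset_trans BB' (subset_trans BV VY).
by move=> a b aA /(subsetP BB'); apply: eAB.
Qed.

(** * Edges and bipartitions of trees *)

Lemma mem_edges (G : sgraph) (x y : G) : ([set x; y] \in edges G) = adj x y.
Proof.
rewrite inE; apply/existsP/idP => [[u /existsP[v /andP[uv /eqP e]]]|xy].
  have := set21 x y; have := set22 x y; rewrite e.
  have := set21 u v; have := set22 u v; rewrite -e.
  move=> /set2P[?|?] /set2P[?|?] /set2P[?|?] /set2P[?|?]; subst=> //;
    by rewrite ?adj_irr // in uv *; rewrite adj_sym.
by exists x; apply/existsP; exists y; rewrite xy eqxx.
Qed.

Lemma edgesP (G : sgraph) (e : {set G}) :
  reflect (exists x y, adj x y /\ e = [set x; y]) (e \in edges G).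
Proof.
rewrite inE; apply: (iffP existsP) => [[x /existsP[y /andP[xy /eqP ->]]]|].
  by exists x, y.
by move=> [x [y [xy ->]]]; exists x; apply/existsP; exists y; rewrite xy eqxx.
Qed.

(** A repetition-free path inside [S] from [y] to [z], closed up through [x], would be a cycle;
    [z != y] makes the path nontrivial, which gives the three vertices that [is_cycle] demands. *)
Lemma attached_unique (G : sgraph) (S : {set G}) (x y z : G) :
  acyclic G ->
  (forall u v, u \in S -> v \in S ->
    connect [rel u v | [&& adj u v, u \in S & v \in S]] u v) ->
  x \notin S -> y \in S -> z \in S -> adj x y -> adj x z -> z = y.
Proof.
move=> acyc connS xS yS zS xy xz; apply/eqP/negPn/negP => zy.
have /connectP[p0 pth0 lst0] := connS y z yS zS.
case: (shortenP pth0) lst0 => p pth unq _ lst.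
have adjp : path (@adj G) y p by apply: sub_path pth => u v /= /and3P[].
have pS : {subset p <= S}.
  elim: p (y) pth {unq lst adjp} => // a p IHp b /= /andP[/and3P[_ _ aS] /IHp h] c.
  by rewrite inE => /predU1P[->//|]; apply: h.
apply: (acyc (x :: y :: p)); split.
  apply/andP; split; first by rewrite /= xy rcons_path adjp -lst adj_sym.
  rewrite cons_uniq unq andbT inE negb_or; apply/andP; split.
    by apply: contraNneq xS => ->.
  by apply: contra xS => /pS.
by case: p lst {unq adjp pS pth} zy => //= ->; rewrite eqxx.
Qed.

(* Growing a connected set S by a vertex adjacent to it: acyclicity forces that
   vertex to have a single neighbour in S. *)
Lemma tree_grow (G : sgraph) (k : nat) : is_tree G -> k < #|G| ->
  exists S : {set G}, [/\ #|S| = k.+1,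
    forall x y, x \in S -> y \in S ->
      connect [rel u v | [&& adj u v, u \in S & v \in S]] x y,
    exists A : {set G}, forall x y, x \in S -> y \in S -> adj x y ->
      (x \in A) != (y \in A)
    & #|[set e in edges G | e \subset S]| < #|S|].
Proof.
move=> [G0 conn acyc]; elim: k => [_|k IHk ltkG].
  have [r _] := card_gt0P G0; exists [set r]; split.
  - by rewrite cards1.
  - by move=> x y /set1P-> /set1P->; apply: connect0.
  - by exists set0 => x y /set1P-> /set1P->; rewrite adj_irr.
  - rewrite cards1 ltnS leqn0 cards_eq0; apply/eqP/setP => e; rewrite in_set0.
    apply/negP => /setIdP[/edgesP[x [y [xy ->]]]].
    by rewrite subUset !sub1set => /andP[/set1P xr /set1P yr]; rewrite xr yr adj_irr in xy.
have [S [cS connS [A colA] cE]] := IHk (ltnW ltkG).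
have [/exists_inP[x xS /exists_inP[y yS xy]]|/negP noxy] :=
    boolP [exists x in ~: S, exists y in S, adj x y]; last first.
  have [s sS] : exists s, s \in S by apply/card_gt0P; rewrite cS.
  have [z zS] : exists z, z \in ~: S.
    by apply/card_gt0P; have := cardsC S; rewrite cS; lia.
  have clS : closed (@adj G) (mem S).
    apply: intro_closed; first exact: sym_connect_sym (@adj_sym G).
    move=> u v uv uS; apply/negPn/negP => vS; apply: noxy.
    apply/exists_inP; exists v; first by rewrite inE.
    by apply/exists_inP; exists u; rewrite // adj_sym.
  by have := closed_connect clS (conn s z); rewrite /= sS; rewrite inE in zS; case: (z \in S) zS.
rewrite inE in xS.
have uniq_y z : z \in S -> adj x z -> z = y.
  by move=> zS; apply: attached_unique connS xS yS zS xy.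
exists (x |: S); split.
- by rewrite cardsU1 xS cS.
- set e' := (X in connect X).
  have e'sym : connect_sym e'.
    by apply: sym_connect_sym => u v; rewrite /e' /= adj_sym [(u \in _) && _]andbC.
  have to_y u : u \in x |: S -> connect e' u y.
    case/setU1P=> [->|uS]; first by apply: connect1; rewrite /e' /= xy setU11 setU1r.
    apply: connect_sub (connS u y uS yS) => a b /= /and3P[ab aS bS].
    by apply: connect1; rewrite /e' /= ab !setU1r.
  move=> u v /to_y uy /to_y vy; apply: connect_trans uy _.
  by rewrite e'sym.
(* The new vertex [x] gets the side opposite to [y], its only neighbour in [S]. *)
- exists (if y \in A then A :\ x else x |: A).
  have inA u : u \in S -> (u \in if y \in A then A :\ x else x |: A) = (u \in A).
    move=> uS; have ux : u != x by apply: contraNneq xS => <-.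
    by case: ifP; rewrite !inE ?ux // (negPf ux).
  have xA : (x \in if y \in A then A :\ x else x |: A) = (y \notin A).
    by case: ifP; rewrite !inE eqxx.
  move=> u v /setU1P[->|uS] /setU1P[->|vS] uv.
  + by rewrite adj_irr in uv.
  + by rewrite xA inA // (uniq_y v) // ; case: (y \in A).
  + by rewrite xA inA // (uniq_y u) // 1?adj_sym //; case: (y \in A).
  + by rewrite !inA // colA.
- rewrite cardsU1 xS add1n ltnS; apply: leq_trans cE.
  have sub : [set e in edges G | e \subset x |: S] \subset
             [set x; y] |: [set e in edges G | e \subset S].
    apply/subsetP => e /setIdP[/edgesP[u [v [uv ->]]]].
    rewrite subUset !sub1set => /andP[/setU1P[ux|uS] /setU1P[vx|vS]].
    + by rewrite ux vx adj_irr in uv.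
    + by rewrite ux (uniq_y v) ?setU11 // -ux.
    + by rewrite vx (uniq_y u) 1?setUC ?setU11 // -vx adj_sym.
    + by rewrite setU1r // inE mem_edges uv subUset !sub1set uS.
  apply: leq_trans (subset_leq_card sub) _; rewrite cardsU1.
  by case: (_ \notin _).
Qed.

(** Growing to [#|G|] vertices makes [S] everything; the larger of [A] and its complement is kept.
    The two bounds combine to [#|edges G| < 2 * #|A|], as [subset_sums] requires of the degrees. *)
Lemma tree_bipartition (G : sgraph) : is_tree G ->
  (exists A : {set G}, (forall x y, adj x y -> (x \in A) != (y \in A)) /\
     #|G| <= 2 * #|A|) /\ #|edges G| < #|G|.
Proof.
move=> treeG; have [G0 _ _] := treeG.
have [|S [cS _ [A colA] cE]] := tree_grow (k := #|G|.-1) treeG; first by lia.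
have ST x : x \in S.
  suff -> : S = setT by rewrite inE.
  by apply/eqP; rewrite eqEcard subsetT cardsT cS; lia.
split; last first.
  rewrite -[#|G|]prednK // -cS; apply: leq_trans cE; rewrite ltnS.
  by apply/subset_leq_card/subsetP => e eG; rewrite inE eG; apply/subsetP.
have [le|lt] := leqP #|G| (2 * #|A|).
  by exists A; split=> // x y; apply: colA.
exists (~: A); split; last by have := cardsC A; lia.
by move=> x y /(colA x y (ST x) (ST y)); rewrite !inE (inj_eq negb_inj).
Qed.

(** An edge has only one end in [A], hence at most one in [Z], so edges meeting [Z] correspond to
    adjacent ordered pairs with first entry in [Z]. *)
Lemma card_incident_edges (G : sgraph) (A Z : {set G}) :
  (forall x y, adj x y -> (x \in A) != (y \in A)) -> Z \subset A ->
  #|[set e in edges G | [exists x in Z, x \in e]]| =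
  \sum_(x in Z) #|[set y | adj x y]|.
Proof.
move=> colA /subsetP ZA.
pose P := [set p : G * G | (p.1 \in Z) && adj p.1 p.2].
have -> : [set e in edges G | [exists x in Z, x \in e]] =
          [set [set p.1; p.2] | p in P].
  apply/setP => e; apply/setIdP/imsetP => [[/edgesP[x [y [xy ->]]]]|].
    case/exists_inP=> z zZ /set2P[] zE; rewrite zE in zZ.
      by exists (x, y); rewrite // inE zZ.
    by exists (y, x); rewrite ?inE /= ?zZ 1?adj_sym // setUC.
  move=> [[x y]]; rewrite inE /= => /andP[xZ xy] ->; rewrite mem_edges xy; split=> //.
  by apply/exists_inP; exists x; rewrite ?set21.
rewrite card_in_imset => [|[x y] [u v]]; last first.
  rewrite !inE /= => /andP[xZ xy] /andP[uZ uv] eqe.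
  have := colA _ _ xy; have := colA _ _ uv; rewrite (ZA x) // (ZA u) // => vA yA.
  have xu : x = u.
    have : x \in [set u; v] by rewrite -eqe set21.
    by case/set2P=> // xv; rewrite -xv ZA in vA.
  rewrite xu; congr (_, _).
  have : y \in [set u; v] by rewrite -eqe set22.
  by case/set2P=> // yu; rewrite yu ZA in yA.
under eq_bigr do rewrite -sum1dep_card.
by rewrite pair_big_dep /= sum1dep_card.
Qed.

(** * Monochromatic bicliques sharing a side *)

(** A quarter of the pairs suffices for [dense_biclique], and [e] or its negation holds on that
    many. *)
Lemma biclique_ramsey (W : finType) (e : rel W) (t n : nat) (X Y : {set W}) :
  0 < t -> KST_bound t <= n -> #|X| = n -> #|Y| = n ->
  exists A B : {set W}, [/\ A \subset X, B \subset Y, #|A| = t, #|B| = t &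
    (forall a b, a \in A -> b \in B -> e a b) \/
    (forall a b, a \in A -> b \in B -> ~~ e a b)].
Proof.
move=> t0 nt cX cY; pose e' := [rel u v | ~~ e u v].
have total : \sum_(v in Y) #|[set u in X | e u v]| +
             \sum_(v in Y) #|[set u in X | e' u v]| = n ^ 2.
  rewrite -big_split /= -mulnn -{1}cY -sum_nat_const; apply: eq_bigr => v _.
  rewrite -cX -(cardsID [set u | e u v] X); congr (_ + _); apply: eq_card => u.
    by rewrite !inE.
  by rewrite !inE andbC.
have [le|lt] := leqP (n ^ 2) (4 * \sum_(v in Y) #|[set u in X | e u v]|).
  have [A [B [AX BY cA cB eAB]]] := dense_biclique t0 nt cX cY le.
  by exists A, B; split=> //; left.
have [|A [B [AX BY cA cB eAB]]] := dense_biclique (e := e') t0 nt cX cY.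
  by move: lt total; set S := \sum_(v in Y) _; set S' := \sum_(v in Y) _; lia.
by exists A, B; split=> //; right.
Qed.

Lemma split_biclique (n t : nat) (R B : {set {set Knn n}}) :
  0 < t -> KST_bound (KST_bound t) <= n -> two_coloring R B ->
  n ^ 2 <= 4 * #|R| -> n ^ 2 <= 4 * #|B| ->
  exists C D E : {set Knn n}, [/\ t <= #|C|, t <= #|D|, t <= #|E|,
    forall c x, c \in C -> x \in E -> [set c; x] \in R &
    forall d x, d \in D -> x \in E -> [set d; x] \in B].
Proof.
move=> t0 nt [RB disj] cR cB.
pose X : {set Knn n} := [set inl i | i in 'I_n].
pose Y : {set Knn n} := [set inr i | i in 'I_n].
have cX : #|X| = n by rewrite card_imset ?card_ord // => i j [].
have cY : #|Y| = n by rewrite card_imset ?card_ord // => i j [].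
have adjXY u v : u \in X -> v \in Y -> [set u; v] \in edges (Knn n).
  by case/imsetP=> i _ ->; case/imsetP=> j _ ->; rewrite mem_edges.
(* Bicliques of side [s] are found in each color first, large enough for [biclique_ramsey] to
   extract side [t] from [A1] and [B2]. *)
pose s := KST_bound t.
have ts : t <= s by rewrite /s /KST_bound; lia.
have s0 : 0 < s by apply: leq_trans ts.
have mono (Q : {set {set Knn n}}) : Q \subset edges (Knn n) -> n ^ 2 <= 4 * #|Q| ->
    exists A B : {set Knn n}, [/\ A \subset X, B \subset Y, #|A| = s, #|B| = s &
      forall a b, a \in A -> b \in B -> [set a; b] \in Q].
  move=> /subsetP Qe cQ.
  apply: (@dense_biclique _ [rel u v | [set u; v] \in Q] s n X Y) => //.
  apply: leq_trans cQ _; rewrite leq_mul2l /=.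
  under eq_bigr do rewrite -sum1dep_card.
  rewrite pair_big_dep /= sum1dep_card.
  set P := [set p | _].
  apply: leq_trans (leq_imset_card (fun p : Knn n * Knn n => [set p.2; p.1]) P).
  apply/subset_leq_card/subsetP => q qQ; apply/imsetP.
  have /edgesP[[i|i] [[j|j] [// _ qE]]] := Qe q qQ.
    by exists (inr j, inl i) => //; rewrite inE /= -qE qQ !imset_f.
  by exists (inr i, inl j); rewrite /= 1?setUC // inE /= setUC -qE qQ !imset_f.
have [||A1 [B1 [A1X B1Y cA1 cB1 red]]] := mono R => //.
  by rewrite -RB subsetUl.
have [||A2 [B2 [A2X B2Y cA2 cB2 blue]]] := mono B => //.
  by rewrite -RB subsetUr.
have [A [B' [AA1 BB2 cA cB' mAB]]] :=
  @biclique_ramsey _ [rel u v | [set u; v] \in R] t s A1 B2 t0 (leqnn _) cA1 cB2.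
(* A red biclique on [A], [B'] shares [B'] with the blue one on [A2], [B2]; a blue one shares [A]
   with the red one on [A1], [B1]. The shared side becomes [E]. *)
case: mAB => mAB; rewrite /= in mAB.
  exists A, A2, B'; rewrite cA cA2 cB'; split=> // d x dA2 xB'.
  exact: blue dA2 (subsetP BB2 x xB').
exists B1, B', A; rewrite cA cB1 cB'; split=> // c x.
  by move=> cB1' xA; rewrite setUC red // (subsetP AA1).
move=> cB'' xA; rewrite setUC.
have : [set x; c] \in R :|: B.
  rewrite RB; apply: adjXY.
    exact: (subsetP A1X) (subsetP AA1 _ xA).
  exact: (subsetP B2Y) (subsetP BB2 _ cB'').
by rewrite inE (negPf (mAB x c xA cB'')).
Qed.

(** * Embedding the tree with prescribed colors *)

Lemma ex_injection (U W : finType) (A : {set W}) : #|U| <= #|A| ->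
  exists2 f : U -> W, injective f & forall x, f x \in A.
Proof.
move=> leUA; exists (fun x => enum_val (widen_ord leUA (enum_rank x))) => [x y|x].
  by move=> /enum_val_inj/(congr1 val)/= /ord_inj; apply: enum_rank_inj.
exact: enum_valP.
Qed.

(** The copy has exactly the image edges, so further edges of [Knn n] between image vertices are
    harmless and [f] need only preserve adjacency in one direction. *)
Lemma colored_copy_of_embedding (n : nat) (R B : {set {set Knn n}}) (G : sgraph)
    (f : G -> Knn n) :
  injective f -> (forall x y, adj x y -> adj (f x) (f y)) ->
  has_colored_copy R B G #|[set e in edges G | f @: e \in R]|
                         #|[set e in edges G | f @: e \in B]|.
Proof.
move=> injf adjf.
have f2 x y : f @: [set x; y] = [set f x; f y] by rewrite imsetU !imset_set1.
have injf2 : injective (fun e : {set G} => f @: e) by apply: imset_inj.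
pose F := [set f @: e | e : {set G} in edges G].
have FE : F \subset edges (Knn n).
  by apply/subsetP => _ /imsetP[_ /edgesP[x [y [xy ->]]] ->]; rewrite f2 mem_edges adjf.
have FV e : e \in F -> e \subset f @: [set: G].
  by case/imsetP=> e' _ ->; rewrite imsetS ?subsetT.
have cF (Q : {set {set Knn n}}) : #|F :&: Q| = #|[set e in edges G | f @: e \in Q]|.
  rewrite -(card_imset _ injf2); apply: eq_card => e; rewrite inE.
  apply/andP/imsetP => [[/imsetP[e' e'G ->] Qe]|[e' /setIdP[e'G Qe] ->]].
    by exists e'; rewrite // inE e'G.
  by rewrite imset_f.
exists (Subgraph FE FV); split; [|exact: cF|exact: cF].
exists (fun x => exist _ (f x) (imset_f f (in_setT x))); split.
  apply: inj_card_bij => [x y [/injf]//|].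
  by rewrite card_sig card_imset // cardsT.
move=> x y; rewrite /= /sub_adj /= -f2 (mem_imset _ _ injf2).
exact: mem_edges.
Qed.

Lemma tree_colored_copy (n : nat) (R B : {set {set Knn n}}) (T : sgraph) (r b : nat) :
  is_tree T -> KST_bound (KST_bound #|T|) <= n -> two_coloring R B ->
  n ^ 2 <= 4 * #|R| -> n ^ 2 <= 4 * #|B| -> r + b = #|edges T| ->
  has_colored_copy R B T r b.
Proof.
move=> treeT nT colRB cR cB rb; have [T0 connT _] := treeT.
have [[A [colA leA]] ltE] := tree_bipartition treeT.
have EA : #|edges T| = \sum_(x in A) #|[set y | adj x y]|.
  rewrite -(card_incident_edges colA (subxx A)); apply: eq_card => e; rewrite inE.
  case: (boolP (e \in edges T)) => // /edgesP[x [y [xy ->]]]; symmetry; apply/exists_inP.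
  have [xA|xA] := boolP (x \in A); first by exists x; rewrite ?set21.
  exists y; rewrite ?set22 //.
  by have := colA x y xy; rewrite (negPf xA); case: (y \in A).
have [Z ZA cZ] : exists2 Z : {set T}, Z \subset A &
    \sum_(x in Z) #|[set y | adj x y]| = r.
  (* In the one-vertex tree the degree is 0, so the positivity required by [subset_sums] fails;
     there [r = 0]. *)
  have [m0|m0] := posnP #|edges T|.
    by exists set0; rewrite ?sub0set ?big_set0 //; lia.
  apply: subset_sums; rewrite -?EA; try lia.
  move=> x _; have [e eT] := card_gt0P m0.
  have [u [v [uv _]]] := edgesP _ eT.
  have [y yx] : exists y, y != x.
    have [ux|] := eqVneq u x; last by exists u.
    by exists v; apply: contraTneq uv => ->; rewrite ux adj_irr.
  have /connectP[[|z p] /= pth lst] := connT x y; first by rewrite lst eqxx in yx.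
  by apply/card_gt0P; exists z; rewrite inE; case/andP: pth.
have [C [D [E [cC cD cE red blue]]]] := split_biclique T0 nT colRB cR cB.
have [RB disjRB] := colRB.
have [g injg gC] := ex_injection cC.
have [h injh hD] := ex_injection cD.
have [k injk kE] := ex_injection cE.
pose f x := if x \in Z then g x else if x \in A then h x else k x.
(* The colors force disjointness: a vertex shared with [E] would carry a loop, and one shared by [C]
   and [D] an edge of both colors. *)
have disjCE c : c \in C -> c \in E -> False.
  move=> cC' cE'; have := red c c cC' cE'.
  move/(subsetP (subsetUl R B)); rewrite RB mem_edges.
  by rewrite adj_irr.
have disjDE c : c \in D -> c \in E -> False.
  move=> cC' cE'; have := blue c c cC' cE'.
  move/(subsetP (subsetUr R B)); rewrite RB mem_edges.
  by rewrite adj_irr.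
have disjCD c : c \in C -> c \in D -> False.
  have [x _] := card_gt0P T0; move=> cC' cD'.
  have := disjointFr disjRB (red c (k x) cC' (kE x)).
  by rewrite blue.
have injf : injective f.
  move=> x y; rewrite /f.
  case: ifP => _; [|case: ifP => _]; (case: ifP => _; [|case: ifP => _]);
    move=> fxy; do ?[exact: injg|exact: injh|exact: injk]; exfalso.
  - by apply: (disjCD (g x)); rewrite // fxy.
  - by apply: (disjCE (g x)); rewrite // fxy.
  - by apply: (disjCD (g y)); rewrite // -fxy.
  - by apply: (disjDE (h x)); rewrite // fxy.
  - by apply: (disjCE (g y)); rewrite // -fxy.
  - by apply: (disjDE (h y)); rewrite // -fxy.
(* The unique end of [e] in [A] goes to [C] if it lies in [Z] and to [D] otherwise, while the other
   end goes to [E]. *)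
have fedge e : e \in edges T ->
    if [exists x in Z, x \in e] then f @: e \in R else f @: e \in B.
  case/edgesP=> [x [y [xy ->]]].
  wlog xA : x y xy / x \in A.
    move=> H; have [xA|xA] := boolP (x \in A); first exact: H.
    rewrite setUC; apply: H; first by rewrite adj_sym.
    by have := colA x y xy; rewrite (negPf xA); case: (y \in A).
  have yA : y \notin A by have := colA x y xy; rewrite xA.
  have yZ : y \notin Z by apply: contra yA => /(subsetP ZA).
  have -> : [exists z in Z, z \in [set x; y]] = (x \in Z).
    apply/exists_inP/idP => [[z zZ /set2P[<-//|zy]]|xZ]; last by exists x; rewrite ?set21.
    by rewrite -zy zZ in yZ.
  rewrite imsetU !imset_set1 /f xA (negPf yA) (negPf yZ).
  by case: (x \in Z); [apply: red|apply: blue].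
have adjf x y : adj x y -> adj (f x) (f y).
  rewrite -!mem_edges -RB => /fedge; rewrite imsetU !imset_set1 inE.
  by case: ifP => _ ->; rewrite ?orbT.
have redE : #|[set e in edges T | f @: e \in R]| = r.
  rewrite -cZ -(card_incident_edges colA ZA); apply: eq_card => e; rewrite in_set [RHS]in_set.
  apply: andb_id2l => /fedge; case: ifP => // _.
  exact: disjointFl disjRB.
have blueE : #|[set e in edges T | f @: e \in B]| = b.
  apply/eqP; rewrite -(eqn_add2l r) rb -{1}redE.
  rewrite -(cardsID [set e : {set T} | f @: e \in R] (edges T)); apply/eqP.
  congr (_ + _); apply: eq_card => e.
    by rewrite in_set in_setI [e \in [set _ | _ \in R]]in_set.
  rewrite in_set in_setD [e \in [set _ | _ \in R]]in_set andbC.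
  apply: andb_id2r => /fedge; case: ifP => _ fe.
    by rewrite fe (disjointFr disjRB fe).
  by rewrite fe (disjointFl disjRB fe).
by rewrite -redE -blueE; apply: colored_copy_of_embedding.
Qed.

Theorem theorem9 (T : sgraph) (hT : is_tree T) : bipartite_omnitonal T.
Proof.
split; first by have [[A [colA _]] _] := tree_bipartition hT; exists A.
exists (KST_bound (KST_bound #|T|)) => n nT.
have n2 : 2 <= n.
  have [T0 _ _] := hT; apply: leq_trans nT; rewrite /KST_bound; lia.
have n4 : 4 <= n ^ 2 by rewrite (leq_exp2r 2 n (e := 2)).
(* One admissible value suffices. Classes larger than it have at least [(n ^ 2)./2] edges, hence at
   least [n ^ 2 / 4] since [n ^ 2 >= 4]; that bound also keeps [.-1] from truncating. *)
apply: (@ex_least _ (n ^ 2)./2.-1); split=> [|R B colRB]; first by lia.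
rewrite leq_min => /andP[cR cB] r b rb.
by apply: tree_colored_copy rb => //; lia.
Qed.
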